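(* Let $(R,M)$ be a finite commutative local ring with identity and let $U(R)$ be the set of units of $R$. If $U(R)-\{1\}$ is a connected subset of $\Gamma_{\mathrm{Aut}\,R}(R)$, then $R$ is isomorphic to one of the following: (1) $\mathbb{Z}_2$, $\mathbb{Z}_3$, $\mathbb{Z}_4$ or $\mathbb{F}_4$; (2) $\mathbb{Z}_2[X_1,\ldots,X_m]/I$ for some integer $m\ge 1$, where $I$ is the ideal of $\mathbb{Z}_2[X_1,\ldots,X_m]$ generated by $\{X_iX_j \mid 1\le i,j\le m\}$.
   Context: All rings are commutative with identity; $\mathbb{Z}_n$ is the ring of integers modulo $n$ and $\mathbb{F}_q$ is the field with $q$ elements; $(R,M)$ denotes a local ring with maximal ideal $M$. $\mathrm{Aut}\,R$ is the group of ring automorphisms of $R$. The graph $\Gamma_{\mathrm{Aut}\,R}(R)$ is the simple graph whose vertices are the elements of $R$, where two distinct vertices $x,y$ are adjacent if and only if there is $\sigma\in\mathrm{Aut}\,R$ with $\sigma(x)=y$. A subset $S\subset R$ is connected in this graph if any two distinct elements of $S$ are joined by a path; equivalently, for all $a,b\in S$ there is $\sigma\in\mathrm{Aut}\,R$ with $\sigma(a)=b$. The empty set counts as connected. *)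

(* Defs.v *)
From HB Require Import structures.
From mathcomp Require Import all_boot all_order all_fingroup all_algebra all_field.
From mathcomp Require Import ring_quotient boolp mpoly.

Set Implicit Arguments.
Unset Strict Implicit.
Unset Printing Implicit Defensive.

Import GRing.Theory.

Local Open Scope ring_scope.

Definition ring_isom (R S : nzRingType) : Prop :=
  exists f : {rmorphism R -> S}, bijective f.

(* [idealr_closed] includes properness (1 does not belong to the ideal). *)
Definition maximal_ideal (R : finComNzRingType) (M : {set R}) : Prop :=
  idealr_closed M /\
  forall N : {set R}, idealr_closed N -> M \subset N -> N = M.

Definition local_ring (R : finComNzRingType) (M : {set R}) : Prop :=
  maximal_ideal M /\ forall N : {set R}, maximal_ideal N -> N = M.

(* Permutations are bijective, so Aut R is the set of those that are additive
   and multiplicative; see [ring_autP]. *)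
Definition ring_aut (R : finComNzRingType) : {set {perm R}} :=
  [set s : {perm R} | [&& [forall x, forall y, s (x + y) == s x + s y],
                          [forall x, forall y, s (x * y) == s x * s y]
                        & s 1 == 1]].

Lemma ring_autP (R : finComNzRingType) (s : {perm R}) :
  reflect (exists f : {rmorphism R -> R}, f =1 s) (s \in ring_aut R).
Proof.
rewrite inE; apply: (iffP and3P) => [[/'forall_'forall_eqP sD sM /eqP s1]|].
  have sM' x y : s (x * y) = s x * s y.
    by apply/eqP; move/forallP/(_ x)/forallP/(_ y): sM.
  have sB : zmod_morphism s.
    have s0 : s 0 = 0 by apply: (addrI (s 0)); rewrite -sD !addr0.
    by move=> x y; apply: (addIr (s y)); rewrite -sD !subrK.
  pose fA := GRing.isZmodMorphism.Build R R s sB.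
  pose fM := GRing.isMonoidMorphism.Build R R s (s1, sM').
  pose f : {rmorphism R -> R} := HB.pack (fun_of_perm s) fA fM.
  by exists f.
case=> f fs; split; last by rewrite -fs rmorph1.
- by apply/forallP=> x; apply/forallP=> y; rewrite -!fs rmorphD.
- by apply/forallP=> x; apply/forallP=> y; rewrite -!fs rmorphM.
Qed.

Lemma ring_aut_group_set (R : finComNzRingType) : group_set (ring_aut R).
Proof.
apply/group_setP; split=> [|s t /ring_autP[f fs] /ring_autP[g gt]].
  by apply/ring_autP; exists (idfun : {rmorphism R -> R}) => x; rewrite perm1.
apply/ring_autP; exists (g \o f : {rmorphism R -> R}) => x.
by rewrite permM /= fs gt.
Qed.

Canonical ring_aut_group (R : finComNzRingType) : {group {perm R}} :=
  Group (ring_aut_group_set R).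

Definition aut_graph (R : finComNzRingType) : rel R :=
  fun x y => (x != y) && [exists s in ring_aut R, s x == y].

(* Paths may leave S, as in the usual reading of "joined by a path in the
   graph"; for [aut_graph] this is immaterial, the components being cliques. *)
Definition connected_subset (T : finType) (e : rel T) (S : {set T}) : Prop :=
  {in S &, forall x y, connect e x y}.

Definition F4 : finFieldType := s2val (@pPrimePowerField 2 2 isT isT).

Lemma card_F4 : #|F4| = 4.
Proof. exact: s2valP' (@pPrimePowerField 2 2 isT isT). Qed.

Definition gen_ideal (A : comNzRingType) (I : finType) (g : I -> A) (p : A) :
    bool :=
  `[< exists c : I -> A, p = \sum_i c i * g i >].

Definition XX_ideal (m : nat) : {mpoly 'Z_2[m]} -> bool :=
  gen_ideal (fun ij : 'I_m * 'I_m => 'X_(ij.1) * 'X_(ij.2)).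

Lemma XX_ideal_closed (m : nat) : idealr_closed (@XX_ideal m).
Proof.
split=> [||a u v /asboolP[c ->] /asboolP[d ->]].
- by apply/asboolP; exists (fun=> 0); rewrite big1 // => i _; rewrite mul0r.
- apply/negP => /asboolP[c /(congr1 (meval (fun=> 0)))].
  rewrite meval1 raddf_sum big1 => [/eqP|i _]; first by rewrite oner_eq0.
  by rewrite /= !mevalM mevalXU mul0r mulr0.
- apply/asboolP; exists (fun i => a * c i + d i).
  rewrite mulr_sumr -big_split; apply: eq_bigr => i _ /=.
  by rewrite mulrDl mulrA.
Qed.

HB.instance Definition _ (m : nat) :=
  isIdealr.Build {mpoly 'Z_2[m]} (@XX_ideal m) (@XX_ideal_closed m).

Definition XX_idealr (m : nat) : idealr {mpoly 'Z_2[m]} := @XX_ideal m.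

(* Z_2[X_1, ..., X_m] / (X_i X_j, 1 <= i, j <= m); the type ascription to
   [idealr] above is what makes the quotient's ring structure inferable. *)
Definition Z2_XX_quot (m : nat) : comNzRingType := {ideal_quot XX_idealr m}.

(* Main.v *)
From HB Require Import structures.
Require Import Defs.
From mathcomp Require Import all_boot all_order all_fingroup all_algebra all_field.
From mathcomp Require Import ring_quotient boolp mpoly zify.
Import GRing.Theory.
Local Open Scope ring_scope.

(** The unit -1 is fixed by every automorphism, so if -1 <> 1 the only units are
    1 and -1; as 1 + M consists of units, |M| <= 2 and R is Z_3 or Z_4.  So let
    -1 = 1.
    If M = 0, then R is a field with 2^n elements.  For x outside {0, 1}, the
    polynomial with roots x^(2^i), i < n, is Frobenius invariant, so it has
    coefficients in F_2 and every conjugate of x is one of its n roots; hence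
    2^n - 2 <= n and n <= 2.
    If M <> 0, then every unit other than 1 is conjugate to one in 1 + M, so
    R = F_2 + M, and Aut R is transitive on M \ {0}.  For x, y in M with
    xy <> 0, some automorphism takes x to xy, so the ideals xyR and xR have the
    same size and coincide; then x = xyr, that is x (1 - yr) = 0 with 1 - yr a
    unit, a contradiction.  Thus M^2 = 0, and a basis of M over F_2 presents R
    as the required quotient. *)

(** * Building ring isomorphisms onto Z_n and onto quotient rings *)

Lemma ring_isom_sym {R S : nzRingType} : ring_isom R S -> ring_isom S R.
Proof.
case=> f [g fK gK].
have gB : zmod_morphism g by apply: can2_zmod_morphism fK gK.
have gM : monoid_morphism g by apply: can2_monoid_morphism fK gK.
pose gA := GRing.isZmodMorphism.Build S R g gB.
pose gMM := GRing.isMonoidMorphism.Build S R g gM.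
pose G : {rmorphism S -> R} := HB.pack g gA gMM.
by exists G; exists f.
Qed.

(** The order n of R annihilates 1, so k -> [k%:R] is a ring morphism from Z_n; its kernel is
    trivial, hence it is bijective by counting. *)
Lemma ring_isom_Zn (R : finComUnitRingType) (n : nat) :
    (1 < n)%N -> #|R| = n ->
    (forall k : nat, (0 < k < n)%N -> k%:R != 0 :> R) ->
  ring_isom R 'Z_n.
Proof.
move=> n_gt1 cardR natR_neq0.
have n0 : n%:R = 0 :> R.
  by rewrite -cardR -FinRing.zmodXgE -cardsT cyclic.expg_cardG ?inE.
have modR k : (k %% n)%N%:R = k%:R :> R.
  by rewrite [in RHS](divn_eq k n) natrD natrM n0 mulr0 add0r.
have modZ (k : nat) : (k %% (Zp_trunc n).+2)%N%:R = k%:R :> R.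
  by rewrite Zp_cast // modR.
pose f (z : 'Z_n) : R := (z : nat)%:R.
have fD : {morph f : x y / x + y} by move=> x y; rewrite /f /= modZ natrD.
have fM : monoid_morphism f by split=> [|x y]; rewrite /f /= modZ ?natrM.
have f0 : f 0 = 0 by [].
have fB : zmod_morphism f.
  by move=> x y; apply: (addIr (f y)); rewrite -fD !subrK.
pose fA := GRing.isZmodMorphism.Build _ _ f fB.
pose fMM := GRing.isMonoidMorphism.Build _ _ f fM.
pose F : {rmorphism 'Z_n -> R} := HB.pack f fA fMM.
apply: ring_isom_sym; exists F => /=; apply: inj_card_bij; last first.
  by rewrite cardR card_ord Zp_cast.
apply: (raddf_inj (f := F)) => z /eqP fz0; apply/val_inj/eqP => /=.
apply: contraTT fz0; rewrite -lt0n => z_gt0; apply: natR_neq0.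
by rewrite z_gt0 (leq_trans (ltn_ord z)) // Zp_cast.
Qed.

(** First isomorphism theorem: [g] is a chosen section of [f]. The class of [g x] depends only on
    [f (g x) = x], which makes [h] a morphism. *)
Lemma ring_isom_quot {R A : comNzRingType} (I : idealr A)
    (f : {rmorphism A -> R}) :
    (forall x, exists p, f p = x) -> (forall p, (f p == 0) = (p \in I)) ->
  ring_isom R {ideal_quot I}.
Proof.
move=> /choice[g gK] kerf.
pose pi (p : A) : {ideal_quot I} := \pi_({ideal_quot I})%qT p.
pose h x : {ideal_quot I} := pi (g x).
have piP p q : f p = f q -> pi p = pi q.
  move=> fpq; apply/eqP; rewrite /pi -[_ == _]Quotient.idealrBE -kerf.
  by rewrite rmorphB fpq subrr.
have hB : zmod_morphism h.
  move=> x y; rewrite /h -[RHS](rmorphB (\pi_({ideal_quot I})%qT)).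
  by apply: piP; rewrite rmorphB !gK.
have hM : monoid_morphism h.
  split=> [|x y].
    rewrite /h -[RHS](rmorph1 (\pi_({ideal_quot I})%qT)).
    by apply: piP; rewrite rmorph1 gK.
  rewrite /h -[RHS](rmorphM (\pi_({ideal_quot I})%qT)).
  by apply: piP; rewrite rmorphM !gK.
pose hA := GRing.isZmodMorphism.Build _ _ h hB.
pose hMM := GRing.isMonoidMorphism.Build _ _ h hM.
pose H : {rmorphism R -> {ideal_quot I}} := HB.pack h hA hMM.
exists H; exists (fun q : {ideal_quot I} => f (generic_quotient.repr q)).
  move=> x /=.
  rewrite -[RHS]gK; apply/eqP; rewrite -subr_eq0 -rmorphB kerf.
  by rewrite Quotient.idealrBE reprK.
by move=> q; rewrite /= /h -[RHS]reprK; apply: piP; rewrite gK.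
Qed.

(** * The quotient of Z_2[X_1, ..., X_n] by all products X_i X_j *)

Section XX.
Variable n : nat.
Local Notation P := {mpoly 'Z_2[n]}.
Implicit Types (p q : P) (m : 'X_{1..n}).

Lemma mem_XX i j : 'X_i * 'X_j \in XX_idealr n.
Proof.
apply/asboolP; exists (fun k => (k == (i, j))%:R).
rewrite (bigD1 (i, j)) //= eqxx mul1r big1 ?addr0 // => k /negbTE ->.
by rewrite mul0r.
Qed.

Lemma mnm_neq0 m : m != 0%MM -> exists i m', m = (U_(i) + m')%MM.
Proof.
move=> m_neq0.
have [i mi] : exists i, m i != 0%N.
  apply/existsP; apply: contraNT m_neq0; rewrite negb_exists => /forallP m0.
  by apply/eqP/mnmP => i; rewrite mnm0E; apply/eqP; move: (m0 i); rewrite negbK.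
exists i, (m - U_(i))%MM; rewrite addmC submK //.
by apply/mnm_lepP => j; rewrite mnm1E; case: eqP => // <-; rewrite lt0n.
Qed.

(** By induction on monomials: degree 0 adds to [c], degree 1 adds to [d], and any higher degree is
    a multiple of some X_i X_j. *)
Lemma XX_ideal_affine p : exists (c : 'Z_2) (d : 'I_n -> 'Z_2),
  p - (c%:MP + \sum_i (d i)%:MP * 'X_i) \in XX_idealr n.
Proof.
elim/mpolyind: p => [|a m p _ _ [c [d Ip]]].
  exists 0, (fun=> 0); rewrite big1 => [|i _]; last by rewrite mpolyC0 mul0r.
  by rewrite mpolyC0 addr0 subr0 rpred0.
have [-> | /mnm_neq0[i [m' ->]]] := eqVneq m 0%MM.
  exists (a + c), d; rewrite mpolyX0 alg_mpolyC mpolyCD.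
  by rewrite -[X in _ - X]addrA opprD addrACA subrr add0r.
have [-> | /mnm_neq0[j [m2 ->]]] := eqVneq m' 0%MM.
  exists c, (fun k => (if k == i then a else 0) + d k).
  under eq_bigr do rewrite mpolyCD mulrDl.
  rewrite big_split /= addrCA (bigD1 i) //= eqxx big1 => [|k /negbTE ->].
    by rewrite addm0 addr0 mul_mpolyC opprD addrACA subrr add0r.
  by rewrite mpolyC0 mul0r.
exists c, d; rewrite -addrA rpredD // !mpolyXD -mul_mpolyC.
by rewrite [X in _ * X]mulrA mulrCA mulrC; apply: idealMr; apply: mem_XX.
Qed.

(** Evaluation at [e] kills every X_i X_j and is onto by spanning. By independence it is injective
    on affine polynomials, which represent all classes, so its kernel is the ideal. *)
Lemma ring_isom_XX {R : comNzRingType} (h : {rmorphism 'Z_2 -> R})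
    (e : 'I_n -> R) :
    (forall i j, e i * e j = 0) ->
    (forall x, exists c d, x = h c + \sum_i h (d i) * e i) ->
    (forall c d, h c + \sum_i h (d i) * e i = 0 ->
       c = 0 /\ forall i, d i = 0) ->
  ring_isom R (Z2_XX_quot n).
Proof.
move=> ee0 span indep.
pose F : {rmorphism P -> R} := mmap h e.
have FC c : F c%:MP = h c by apply: mmapC.
have FX i : F 'X_i = e i by rewrite /F /= mmapX mmap1U.
have Faff c d :
    F (c%:MP + \sum_i (d i)%:MP * 'X_i) = h c + \sum_i h (d i) * e i.
  rewrite rmorphD FC rmorph_sum; congr (_ + _); apply: eq_bigr => i _.
  by rewrite rmorphM FC FX.
have FI p : p \in XX_idealr n -> F p = 0.
  move=> /asboolP[c ->]; rewrite rmorph_sum big1 // => -[i j] _ /=.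
  by rewrite !rmorphM !FX ee0 mulr0.
apply: (@ring_isom_quot _ _ _ F) => [x | p].
  by have [c [d ->]] := span x; eexists; apply: Faff.
apply/eqP/idP => [Fp0 | /FI //].
have [c [d Ip]] := XX_ideal_affine p.
have /eqP := FI _ Ip; rewrite rmorphB Fp0 sub0r oppr_eq0 Faff => /eqP.
move=> /indep[c0 d0]; move: Ip; rewrite c0 mpolyC0 add0r big1 ?subr0 //.
by move=> i _; rewrite d0 mpolyC0 mul0r.
Qed.
End XX.

(** * Finite fields of characteristic 2 *)

(* [s] is the structure of F_2[a] with a^2 = 1 + a, in coordinates (1, a). *)
Lemma card4_field (F : finFieldType) : #|F| = 4%N ->
  exists s : bool * bool -> F, [/\ bijective s, s (true, false) = 1,
    forall u v, s u + s v = s (u.1 (+) v.1, u.2 (+) v.2) &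
    forall u v, s u * s v = s ((u.1 && v.1) (+) (u.2 && v.2),
      (u.1 && v.2) (+) (u.2 && v.1) (+) (u.2 && v.2))].
Proof.
move=> cardF.
have ch2 : 2%N \in [pchar F] by apply: (@card_finPcharP _ _ 2).
have [a] : exists a : F, a \notin [:: 0; 1].
  have /subsetPn[a _ a01] : ~~ ([set: F] \subset [:: 0; 1]).
    apply/negP => /subset_leq_card; rewrite cardsT cardF.
    by move=> /leq_trans/(_ (card_size _)).
  by exists a.
rewrite !inE negb_or => /andP[a0 a1].
have addbR (b c : bool) : (b (+) c)%:R = b%:R + c%:R :> F.
  by case: b; case: c; rewrite ?addr0 ?add0r ?(addrr_pchar2 ch2).
have andbR (b c : bool) : (b && c)%:R = b%:R * c%:R :> F.
  by case: b; case: c; rewrite ?mul0r ?mulr0 ?mulr1.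
pose s (u : bool * bool) : F := u.1%:R + u.2%:R * a.
have sD u v : s u + s v = s (u.1 (+) v.1, u.2 (+) v.2).
  by rewrite /s /= !addbR mulrDl addrACA.
have s0 u : s u = 0 -> u = (false, false).
  case: u => -[] [] //; rewrite /s /= ?mul0r ?mul1r ?addr0 ?add0r.
  - by move=> /eqP; rewrite addrC addr_eq0 oppr_pchar2 // (negbTE a1).
  - by move=> /eqP; rewrite oner_eq0.
  - by move=> /eqP; rewrite (negbTE a0).
have s_inj : injective s.
  move=> u v suv; have := s0 (u.1 (+) v.1, u.2 (+) v.2).
  rewrite -sD suv addrr_pchar2 // => /(_ erefl).
  by case: u v {suv} => -[] [] [[] []].
have s_bij : bijective s.
  by apply: inj_card_bij; rewrite // cardF card_prod card_bool.
(* The square of a is one of 0, 1, a, 1 + a; the first three force a = 0 or a = 1. *)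
have a2 : a * a = 1 + a.
  have [t sK tK] := s_bij; have := tK (a * a).
  case: (t _) => -[] []; rewrite /s /= ?mul0r ?mul1r ?addr0 ?add0r //.
  - move=> /esym/eqP; rewrite -expr2 sqrf_eq1 oppr_pchar2 // orbb.
    by rewrite (negbTE a1).
  - by move=> /eqP; rewrite -{1}[a]mulr1 (inj_eq (mulfI a0)) eq_sym (negbTE a1).
  - by move=> /esym/eqP; rewrite mulf_eq0 (negbTE a0).
exists s; split=> // [|u v]; first by rewrite /s /= mul0r addr0.
rewrite /s !(addbR, andbR) /= mulrDl !mulrDr !mulrDl.
rewrite [_ * a * (_ * a)]mulrACA a2 mulrDr mulr1.
rewrite [_ * a * _]mulrAC [_ * (_ * a)]mulrA -!addrA; congr (_ + _).
by rewrite [RHS]addrCA; congr (_ + _); rewrite [RHS]addrCA; congr (_ + _).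
Qed.

Lemma ring_isom_card4_field (F K : finFieldType) :
  #|F| = 4%N -> #|K| = 4%N -> ring_isom F K.
Proof.
move=> /card4_field[s [[s' sK s'K] s1 sD sM]].
move=> /card4_field[t [[t' tK t'K] t1 tD tM]].
pose f x := t (s' x).
have fD : {morph f : x y / x + y}.
  by move=> x y; rewrite /f -{1}[x]s'K -{1}[y]s'K sD sK tD.
have f0 : f 0 = 0 by apply: (addrI (f 0)); rewrite -fD !addr0.
have fB : zmod_morphism f.
  by move=> x y; apply: (addIr (f y)); rewrite -fD !subrK.
have fM : monoid_morphism f.
  split=> [|x y]; first by rewrite /f -s1 sK.
  by rewrite /f -{1}[x]s'K -{1}[y]s'K sM sK tM.
pose fA := GRing.isZmodMorphism.Build _ _ f fB.
pose fMM := GRing.isMonoidMorphism.Build _ _ f fM.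
pose G : {rmorphism F -> K} := HB.pack f fA fMM.
by exists G; exists (fun y => s (t' y)) => x /=; rewrite /f ?tK ?sK ?s'K ?t'K.
Qed.

Lemma frobenius_orbit (F : finFieldType) n : #|F| = (2 ^ n)%N ->
  forall (s : {rmorphism F -> F}) x, exists2 i, (i < n)%N & s x = x ^+ (2 ^ i).
Proof.
move=> cardF s x.
have ch2 : 2%N \in [pchar F] by exact: card_finPcharP cardF _.
have n_gt0 : (0 < n)%N.
  by rewrite -(ltn_exp2l _ _ (isT : 1 < 2)%N) -cardF finNzRing_gt1.
pose p : {poly F} := \prod_(0 <= i < n) ('X - (x ^+ (2 ^ i))%:P).
have map_p (f : {rmorphism F -> F}) :
    map_poly f p = \prod_(0 <= i < n) ('X - ((f x) ^+ (2 ^ i))%:P).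
  rewrite rmorph_prod; apply: eq_bigr => i _.
  by rewrite rmorphB /= map_polyX map_polyC /= rmorphXn.
(* Frobenius shifts the factors by one; the new last factor is the old first one, as x^(2^n) = x. *)
have p_frob : map_poly (pFrobenius_aut ch2) p = p.
  rewrite map_p /p -(prednK n_gt0) [LHS]big_nat_recr // [RHS]big_nat_recl //=.
  rewrite mulrC; congr (_ * _).
    by rewrite pFrobenius_autE -exprM -expnS prednK // -cardF expf_card.
  by apply: eq_bigr => i _; rewrite pFrobenius_autE -exprM -expnS.
(* By invariance each coefficient c satisfies c^2 = c. *)
have p_coef i : p`_i = 0 \/ p`_i = 1.
  have /polyP/(_ i) := p_frob; rewrite coef_map /= pFrobenius_autE expr2.
  have [-> | pi0] := eqVneq (p`_i) 0; first by left.
  by rewrite -[RHS]mulr1 => /(mulfI pi0); right.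
have p_s : map_poly s p = p.
  apply/polyP=> i; rewrite coef_map /=.
  by case: (p_coef i) => ->; rewrite ?rmorph0 ?rmorph1.
have p_roots y : root p y = (y \in [seq x ^+ (2 ^ i) | i <- iota 0 n]).
  by rewrite -root_prod_XsubC big_map /p /index_iota subn0.
have : root p (s x).
  rewrite -p_s /root horner_map fmorph_eq0 -/(root p x) p_roots.
  by apply/mapP; exists 0; rewrite ?mem_iota ?n_gt0.
by rewrite p_roots => /mapP[i]; rewrite mem_iota => i_lt ->; exists i.
Qed.

Lemma card_field_transitive (F : finFieldType) : 2%N \in [pchar F] ->
    (forall x y : F, x != 0 -> x != 1 -> y != 0 -> y != 1 ->
       exists s : {rmorphism F -> F}, s x = y) ->
  #|F| = 2%N \/ #|F| = 4%N.
Proof.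
move=> ch2 aut_trans.
have [n cardF] : exists n, #|F| = (2 ^ n)%N.
  by eexists; apply: (card_pprimeChar ch2).
have [x /andP[x0 x1] | F2] := pickP [pred x : F | (x != 0) && (x != 1)];
  last first.
  left; have -> : #|F| = #|[set 0; 1 : F]|.
    apply: eq_card => x; rewrite !inE; have /negbT := F2 x.
    by rewrite negb_and !negbK => ->.
  by rewrite cards2 eq_sym oner_eq0.
right.
have le_n : (2 ^ n - 2 <= n)%N.
  have : [set y : F | (y != 0) && (y != 1)] \subset
      [set x ^+ (2 ^ i) | i : 'I_n].
    apply/subsetP=> y; rewrite inE => /andP[y0 y1].
    have [s <-] := aut_trans x y x0 x1 y0 y1.
    have [i lt_in ->] := frobenius_orbit F n cardF s x.
    by apply/imsetP; exists (Ordinal lt_in).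
  move=> /subset_leq_card/leq_trans/(_ (leq_imset_card _ _)).
  rewrite card_ord -cardF; apply: leq_trans.
  have -> : [set y : F | (y != 0) && (y != 1)] = ~: [set 0; 1].
    by apply/setP=> y; rewrite !inE negb_or.
  by rewrite leq_subLR -(cardsC [set 0; 1 : F]) leq_add2r cards2; case: eqP.
(* Three distinct elements rule out n <= 1; with 2^n - 2 <= n only n = 2 remains. *)
have : (3 <= #|F|)%N.
  suff <- : #|[set 0; 1; x : F]| = 3%N by apply: max_card.
  rewrite -setUA cardsU1 !inE cards2 ![_ == x]eq_sym x1 negb_or x0.
  by rewrite eq_sym oner_eq0.
move: le_n; rewrite cardF; case: n {cardF} => [|[|[|n]]] //.
have lt_n : (n < 2 ^ n)%N by apply: ltn_expl.
by rewrite leq_subLR !expnS; lia.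
Qed.

(** * Ideals and units of a finite local ring; automorphisms along paths *)

Lemma principal_idealr_closed (R : finComUnitRingType) (x : R) :
  x \isn't a GRing.unit -> idealr_closed [set x * r | r in [set: R]].
Proof.
move=> xNU; split=> [||a _ _ /imsetP[r _ ->] /imsetP[t _ ->]].
- by apply/imsetP; exists 0; rewrite ?inE ?mulr0.
- apply: contra xNU => /imsetP[r _ xr1]; apply/unitrP; exists r.
  by rewrite -xr1 mulrC.
- by apply/imsetP; exists (a * r + t); rewrite ?inE // mulrDr mulrCA.
Qed.

Lemma maximal_ideal_exists (R : finComNzRingType) (I : {set R}) :
  idealr_closed I -> exists2 M, maximal_ideal M & I \subset M.
Proof.
move=> /asboolP I_ideal.
have [M /maxsetP[/asboolP M_ideal maxM] IM] :=
  @maxset_exists R (fun N : {set R} => `[< idealr_closed N >]) I I_ideal.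
by exists M => //; split=> // N /asboolP; apply: maxM.
Qed.

(** A nonunit generates a proper ideal, which lies in a maximal ideal, necessarily M; conversely, a
    unit in M would put 1 in M. *)
Lemma local_ring_nonunits (R : finComUnitRingType) (M : {set R}) :
  local_ring M -> forall x, (x \in M) = (x \isn't a GRing.unit).
Proof.
move=> [[[_ M1 MD] _] M_uniq] x; apply/idP/idP => [xM | xNU].
  apply: contra M1 => xU; have := MD x^-1 x (0 : R) xM.
  rewrite addr0 mulVr //; apply.
  by have := MD (-1) x x xM xM; rewrite mulN1r addNr.
have [N /M_uniq -> /subsetP] :=
  maximal_ideal_exists _ _ (principal_idealr_closed _ _ xNU).
by apply; apply/imsetP; exists 1; rewrite ?inE ?mulr1.
Qed.

(** The automorphisms along a path are composed. Injectivity is recorded because [nonunit_mul_eq0]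
    uses it to compare sizes of ideals. *)
Lemma connect_aut_graph (R : finComNzRingType) (x y : R) :
  connect (@aut_graph R) x y ->
  exists2 s : {rmorphism R -> R}, injective s & s x = y.
Proof.
case/connectP=> p; elim: p x => [|z p IHp] x /=.
  by move=> _ ->; exists (idfun : {rmorphism R -> R}).
case/andP=> /andP[_ /existsP[s /andP[/ring_autP[f fs] /eqP sxz]]] zp yE.
have [g g_inj gzy] := IHp z zp yE.
have f_inj : injective f := eq_inj perm_inj (fsym fs).
by exists (g \o f : {rmorphism R -> R}); [apply: inj_comp | rewrite /= fs sxz].
Qed.

(** * Rings with nonunits closed under addition and automorphisms transitive on the units other than
    1 *)

Section Transitive.
Variable R : finComUnitRingType.
Hypothesis nonunitD : forall x y : R, x \isn't a GRing.unit ->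
  y \isn't a GRing.unit -> x + y \isn't a GRing.unit.
Hypothesis aut_trans : forall x y : R, x \is a GRing.unit -> x != 1 ->
  y \is a GRing.unit -> y != 1 ->
  exists2 s : {rmorphism R -> R}, injective s & s x = y.

Lemma unit_1D (m : R) : m \isn't a GRing.unit -> 1 + m \is a GRing.unit.
Proof.
move=> mNU; apply: contraT => m1NU; have := nonunitD (1 + m) (- m) m1NU.
by rewrite unitrN addrK unitr1 => /(_ mNU).
Qed.

Lemma isom_neg1_neq1 : -1 != 1 :> R -> ring_isom R 'Z_3 \/ ring_isom R 'Z_4.
Proof.
move=> N1; have unitE (x : R) : x \is a GRing.unit -> x = 1 \/ x = -1.
  move=> xU; have [-> | x1] := eqVneq x 1; [by left | right].
  have [|s _ <-] := aut_trans (-1) x _ N1 xU x1; first by rewrite unitrN1.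
  by rewrite rmorphN1.
have two_neq0 : 2%:R != 0 :> R.
  by apply: contra N1 => /eqP two0; rewrite eq_sym -addr_eq0 -mulr2n two0.
(* For a nonunit x, 1 + x is a unit, hence 1 or -1. *)
have nonunitE (x : R) : x \isn't a GRing.unit -> x = 0 \/ x = - 2%:R.
  move=> /unit_1D/unitE[] /(canRL (addKr 1)) ->.
    by left; rewrite addNr.
  by right; rewrite -opprD -mulr2n.
have cardU : #|[set 1; -1 : R]| = 2%N by rewrite cards2 eq_sym N1.
(* Every element is now one of 0, -2, 1, -1; whether 2 is a unit separates Z_3 from Z_4. *)
have [U2 | NU2] := boolP (2%:R \is a @GRing.unit R); [left | right].
  have RE : [set: R] = 0 |: [set 1; -1].
    apply/setP=> x; rewrite !inE.
    have [/unitE[] -> | /nonunitE[-> | xE]] := boolP (x \is a GRing.unit).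
    - by rewrite eqxx orbT.
    - by rewrite eqxx !orbT.
    - by rewrite eqxx.
    have : x \is a GRing.unit by rewrite xE unitrN.
    by move=> /unitE[] ->; rewrite eqxx !orbT.
  apply: ring_isom_Zn => //; last first.
    by case=> [|[|[|k]]] //= _; rewrite oner_neq0.
  rewrite -cardsT RE cardsU1 cardU !inE ![0 == _]eq_sym oppr_eq0.
  by rewrite oner_eq0.
(* Here 2 is a nonunit other than 0, so 2 = -2. *)
have four0 : 2%:R + 2%:R = 0 :> R.
  have [/eqP|/eqP] : 2%:R = 0 :> R \/ 2%:R = - 2%:R :> R.
  - exact: nonunitE.
  - by rewrite (negbTE two_neq0).
  - by rewrite -addr_eq0 => /eqP.
have RE : [set: R] = 0 |: (2%:R |: [set 1; -1]).
  apply/setP=> x; rewrite !inE.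
  have [/unitE[] -> | /nonunitE[-> | ->]] := boolP (x \is a GRing.unit).
  - by rewrite eqxx !orbT.
  - by rewrite eqxx !orbT.
  - by rewrite eqxx.
  by rewrite [_ == 2%:R]eq_sym -addr_eq0 four0 eqxx orbT.
have unit_neq2 (x : R) : x \is a GRing.unit -> (2%:R == x) = false.
  by move=> xU; apply: contraNF NU2 => /eqP ->.
apply: ring_isom_Zn => //.
  rewrite -cardsT RE 2!cardsU1 cardU !inE ![0 == _]eq_sym oppr_eq0.
  by rewrite oner_eq0 (negbTE two_neq0) !unit_neq2 ?unitrN1 ?unitr1.
case=> [|[|[|[|k]]]] //= _; first by rewrite oner_neq0.
(* The case k = 3: 3 = 0 would make 2 equal to the unit -1. *)
have N1U : (-1 : R) \is a GRing.unit by rewrite unitrN1.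
by apply: contraFN (unit_neq2 _ N1U); rewrite -addr_eq0 -mulrSr.
Qed.

Lemma isom_field : (forall x : R, x \isn't a GRing.unit -> x = 0) ->
  -1 = 1 :> R -> ring_isom R 'Z_2 \/ ring_isom R F4.
Proof.
move=> nonunit0 N1.
have domR : GRing.integral_domain_axiom R.
  move=> x y xy0; case: (boolP (x \is a GRing.unit)) => [xU | /nonunit0 ->].
    by rewrite -[y](mulKr xU) xy0 mulr0 eqxx orbT.
  by rewrite eqxx.
(* The carrier is unchanged, so the automorphisms and the cardinality of R are those of [F]. *)
pose F := FinDomainFieldType domR.
have unitF (x : R) : x != 0 -> x \is a GRing.unit.
  by apply: contraNT => /nonunit0 ->.
have two0 : 2%:R = 0 :> R by rewrite mulr2n -[X in X + _]N1 addNr.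
have ch2 : 2%N \in [pchar F] by apply/andP; split; [|apply/eqP/two0].
have [x y x0 x1 y0 y1 | cF | cF] := card_field_transitive F ch2.
- by have [s _ <-] := aut_trans x y (unitF x x0) x1 (unitF y y0) y1; exists s.
- left; apply: (@ring_isom_Zn R 2 isT cF) => -[|[|k]] //= _.
  by rewrite oner_neq0.
by right; apply: (ring_isom_card4_field F F4 cF card_F4).
Qed.

Lemma nonunit_sum (I : Type) (r : seq I) (F : I -> R) :
  (forall i, F i \isn't a GRing.unit) -> \sum_(i <- r) F i \isn't a GRing.unit.
Proof.
by move=> FNU; elim/big_ind: _ => //; first by rewrite unitr0.
Qed.

Lemma nonunit_mul_eq0 (x y : R) :
  x \isn't a GRing.unit -> y \isn't a GRing.unit -> x * y = 0.
Proof.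
move=> xNU yNU; apply/eqP; apply: contraT => xy0.
have x0 : x != 0 by apply: contraNneq xy0 => ->; rewrite mul0r.
have xyNU : x * y \isn't a GRing.unit by rewrite unitrM negb_and xNU.
(* Transitivity concerns units, so it is applied to 1 + x and 1 + xy; cancelling 1 gives s x =
   xy. *)
have [||||s s_inj] := aut_trans (1 + x) (1 + x * y).
- exact: unit_1D.
- by rewrite -subr_eq0 addrC addKr.
- exact: unit_1D.
- by rewrite -subr_eq0 addrC addKr.
rewrite rmorphD rmorph1 => /addrI sx.
pose I z : {set R} := [set z * r | r in [set: R]].
(* The injection s maps zR into s(z)R; hence |xR| <= |xyR|, which turns the inclusion [sub_I] into
   an equality. *)
have cardI z : (#|I z| <= #|I (s z)|)%N.
  rewrite -(card_imset _ s_inj) subset_leq_card //.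
  apply/subsetP=> _ /imsetP[_ /imsetP[r _ ->] ->].
  by apply/imsetP; exists (s r); rewrite ?inE ?rmorphM.
have sub_I : I (x * y) \subset I x.
  apply/subsetP=> _ /imsetP[r _ ->]; rewrite -mulrA.
  by apply/imsetP; exists (y * r); rewrite ?inE.
have : x \in I (x * y).
  suff -> : I (x * y) = I x by apply/imsetP; exists 1; rewrite ?inE ?mulr1.
  by apply/eqP; rewrite eqEcard sub_I -sx cardI.
case/imsetP=> r _ xE.
have yrU : 1 - y * r \is a GRing.unit.
  by apply: unit_1D => //; rewrite unitrN unitrM negb_and yNU.
move: x0; rewrite -(mulIr_eq0 x (mulIr yrU)) mulrBr mulr1 mulrA -xE subrr.
by rewrite eqxx.
Qed.

Lemma isom_char2_nonfield : -1 = 1 :> R ->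
    (exists2 m : R, m \isn't a GRing.unit & m != 0) ->
  exists m : nat, (1 <= m)%N /\ ring_isom R (Z2_XX_quot m).
Proof.
move=> N1 exm.
have mul0 := nonunit_mul_eq0; have [m0 m0NU m0_neq0] := exm.
have mm0 := mul0 _ _ m0NU m0NU.
(* A unit x other than 1 is s (1 + m0), so x - 1 = s m0, which squares to 0 and cannot be a unit. *)
have unitB1 (x : R) : x \is a GRing.unit -> x - 1 \isn't a GRing.unit.
  move=> xU; have [-> | x1] := eqVneq x 1; first by rewrite subrr unitr0.
  have [||||s _ <-] := aut_trans (1 + m0) x => //.
  - exact: unit_1D.
  - by rewrite -subr_eq0 addrC addKr.
  rewrite rmorphD rmorph1 addrC addKr; apply: contra m0NU => /unitrP[t [_ ts]].
  have : (s m0 * t) ^+ 2 = 0.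
    by rewrite exprMn expr2 -rmorphM mm0 rmorph0 mul0r.
  by rewrite ts expr1n => /eqP; rewrite oner_eq0.
have ch2 : 2%N \in [pchar R] by rewrite inE /= mulr2n -[X in X + _]N1 addNr.
(* R is viewed as an F_2-algebra, so that M becomes a vector space with a basis. *)
pose A := pPrimeCharType ch2.
pose N : seq A := [seq x <- enum R | x \isn't a GRing.unit].
pose V : {vspace A} := <<N>>%VS.
(* Nonunits are stable under sums and scaling, so the span contains nothing else. *)
have memV (x : A) : (x \in V) = ((x : R) \isn't a GRing.unit).
  apply/idP/idP => [xV | xNU].
    rewrite (coord_span (X := in_tuple N) xV).
    apply: nonunit_sum => i; rewrite unitrM negb_and; apply/orP; right.
    have := mem_tnth i (in_tuple N).
    by rewrite (tnth_nth 0) mem_filter => /andP[].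
  by apply: memv_span; rewrite mem_filter xNU mem_enum.
pose e : 'I_(\dim V) -> A := fun i => (vbasis V)`_i.
have eNU i : (e i : R) \isn't a GRing.unit.
  by rewrite -memV; apply/vbasis_mem/memt_nth.
exists (\dim V); split.
  rewrite lt0n dimv_eq0; apply: contraNneq m0_neq0 => V0.
  by have := memV m0; rewrite V0 m0NU memv0.
(* ['F_2] computes to ['Z_2], so [in_alg] can serve as the map [h]. *)
apply: (@ring_isom_XX _ A (in_alg A : {rmorphism 'F_2 -> A}) e).
- by move=> i j; apply: mul0.
- have spanV (x : A) : x \in V -> exists d : 'I_(\dim V) -> 'Z_2,
      x = \sum_i in_alg A (d i) * e i.
    move=> xV; exists (fun i => coord (vbasis V) i x).
    by rewrite {1}(coord_vbasis xV); apply: eq_bigr => i _; rewrite mulr_algl.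
  (* A unit has constant term 1 and a nonunit 0; the rest lies in M. *)
  move=> x; have [xU | xNU] := boolP ((x : R) \is a GRing.unit).
    have [|d dE] := spanV (x - 1); first by rewrite memV unitB1.
    by exists 1, d; rewrite -dE rmorph1 addrC subrK.
  have [|d dE] := spanV x; first by rewrite memV.
  by exists 0, d; rewrite -dE rmorph0 add0r.
move=> c d cd0.
(* If c = 1, then 1 would be the opposite of a combination of nonunits. *)
have c0 : c = 0.
  have [// | c1] : c = 0 \/ c = 1.
    by case: c {cd0} => -[|[|//]] ?; [left | right]; apply: val_inj.
  have : \sum_i in_alg A (d i) * e i \isn't a @GRing.unit R.
    by apply: nonunit_sum => i; rewrite unitrM negb_and eNU orbT.
  move: cd0 => /eqP; rewrite addrC addr_eq0 => /eqP ->; rewrite unitrN.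
  by rewrite c1 rmorph1 unitr1.
split=> //; move: cd0; rewrite c0 rmorph0 add0r.
under eq_bigr do rewrite mulr_algl.
have /freeP := basis_free (vbasisP V); apply.
Qed.
End Transitive.

Theorem theorem4p1 (R : finComUnitRingType) (M : {set R})
    (RM_local : local_ring M)
    (U_connected :
      connected_subset (@aut_graph R)
        ([set x : R | x \is a GRing.unit] :\ 1)) :
  (ring_isom R 'Z_2 \/ ring_isom R 'Z_3 \/ ring_isom R 'Z_4 \/ ring_isom R F4)
  \/ (exists m : nat, (1 <= m)%N /\ ring_isom R (Z2_XX_quot m)).
Proof.
have nonunitE := local_ring_nonunits _ _ RM_local.
have nonunitD (x y : R) : x \isn't a GRing.unit -> y \isn't a GRing.unit ->
    x + y \isn't a GRing.unit.
  have [[[_ _ MD] _] _] := RM_local; rewrite -!nonunitE => xM yM.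
  by rewrite -[x]mul1r; apply: MD.
(* Any two units other than 1 are joined by a path, and composing along it leaves a single
   automorphism. *)
have aut_trans (x y : R) : x \is a GRing.unit -> x != 1 ->
    y \is a GRing.unit -> y != 1 ->
    exists2 s : {rmorphism R -> R}, injective s & s x = y.
  move=> xU x1 yU y1; apply: connect_aut_graph; apply: U_connected.
    by rewrite !inE x1.
  by rewrite !inE y1.
have [N1 | /(isom_neg1_neq1 _ nonunitD aut_trans)] := eqVneq (-1 : R) 1;
  last first.
  by case=> ?; left; right; [left | right; left].
(* From here -1 = 1; the split is on whether M has a nonzero element. *)
have [/existsP[m /andP[mNU m0]] | M0] :=
    boolP [exists m : R, (m \isn't a GRing.unit) && (m != 0)].
  by right; apply: isom_char2_nonfield => //; exists m.
left; have [x xNU | | ] := isom_field _ aut_trans _ N1.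
- apply/eqP; apply: contraNT M0 => x0.
  by apply/existsP; exists x; rewrite xNU.
- by left.
- by do 3!right.
Qed.
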